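(* Let $G$ be a strictly pseudo-solvable group such that $\{2,3,5\}$ forms a triangle in $\overline\Gamma(G)$. Then for every prime $p$ dividing $|G|$ with $p\neq 2,5$ (and $p\ne 3$), $3\text-p$ is not an edge of $\overline\Gamma(G)$.
   Context: For a finite group $G$, the prime graph $\Gamma(G)$ has vertex set the prime divisors of $|G|$, with distinct primes $p,q$ adjacent iff $G$ has an element of order $pq$; $\overline\Gamma(G)$ is its complement graph (so $p\text-q$ is an edge of $\overline\Gamma(G)$ iff $G$ has no element of order $pq$). A finite group is pseudo-solvable if each composition factor is cyclic or isomorphic to $A_5$; it is strictly pseudo-solvable if it is pseudo-solvable but not solvable. *)

(* Defs.v *)
From mathcomp Require Import all_boot all_fingroup all_solvable.
Set Implicit Arguments. Unset Strict Implicit. Unset Printing Implicit Defensive.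
Local Open Scope group_scope.

Definition pg_adj (gT : finGroupType) (G : {set gT}) (p q : nat) : Prop :=
  exists2 x, x \in G & #[x] = (p * q)%N.

Definition cpg_edge (gT : finGroupType) (G : {set gT}) (p q : nat) : Prop :=
  [/\ prime p, prime q, p %| #|G|, q %| #|G| & p != q] /\ ~ pg_adj G p q.

Definition good_factors (gT : finGroupType) (G : {group gT}) (s : seq {group gT}) : bool :=
  all (fun xy : {group gT} * {group gT} =>
         cyclic (xy.1 / xy.2) || ((xy.1 / xy.2) \isog Alt 'I_5))
      (zip (G :: s) s).

(* Pseudo-solvable: all composition factors cyclic or isomorphic to A5
   (checked for every composition series; by Jordan-Hoelder this is
   independent of the series). *)
Definition pseudo_solvable (gT : finGroupType) (G : {group gT}) : Prop :=
  forall s : seq {group gT}, comps G s -> good_factors G s.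

Definition strictly_pseudo_solvable (gT : finGroupType) (G : {group gT}) : Prop :=
  pseudo_solvable G /\ ~~ solvable G.

(* Main.v *)
Require Import Defs.
From mathcomp Require Import all_boot all_fingroup all_solvable.
From mathcomp Require ssralg.
Set Implicit Arguments. Unset Strict Implicit. Unset Printing Implicit Defensive.
Local Open Scope group_scope.

(* Suppose p is a prime other than 2, 3, 5 dividing |G| and G has no elements
   of order 6, 15 or 3p.  Walk down a composition series of G while p divides
   the current term N, and look at the first factor N/N1 with p not dividing
   |N1| or N/N1 = A5.
   - If N/N1 = A5 and p divides |N1|, let P be a Sylow p-subgroup of N1 and
     V = Z(P); by the Frattini argument N_N(P) covers A5, and elements of
     order 3 act fixed-point-freely on V.  A Klein four-group of A5 normalized
     by an element of order 3 lifts to a 2-group Q and an element t of order 3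
     acting fixed-point-freely on Q, so every element of tQ is conjugate to t
     and satisfies 1 + s + s^2 = 0 on V; averaging over Q shows that Q
     centralizes V.  Then C(V) covers A5 and contains an element of order 3
     centralizing V, a contradiction.
   - Otherwise N/N1 is cyclic of order divisible by p (p does not divide 60),
     so an element y of order p normalizes N1 and acts coprimely on it.  Some
     term D of the derived series of N1 has a quotient D/E = A5, and y
     normalizes D.  If y normalizes E, coprime action gives an element of
     order 3 of D commuting with y; otherwise D = E E^y, which yields an
     element of order 15. *)

Section PrimeGraphEdges.
Variable gT : finGroupType.
Implicit Types (G H K N : {group gT}) (x y : gT).

Lemma order_expg_div x d : d %| #[x] -> #[x ^+ (#[x] %/ d)] = d.
Proof. by move=> dv; rewrite orderXdiv ?dvdn_div // divnA // mulKn. Qed.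

Lemma pg_adj_dvd G x q r : x \in G -> q * r %| #[x] -> pg_adj G q r.
Proof.
by move=> Gx dv; exists (x ^+ (#[x] %/ (q * r))); rewrite ?groupX ?order_expg_div.
Qed.

Lemma pg_adjS G K q r : K \subset G -> pg_adj K q r -> pg_adj G q r.
Proof. by move=> sKG [x Kx ox]; exists x; rewrite ?(subsetP sKG). Qed.

Lemma p_elt_dvd_order (p : nat) x : p.-elt x -> x != 1 -> p %| #[x].
Proof. by move=> px ntx; have [] := pgroup_pdiv px; rewrite ?cycle_eq1. Qed.

Lemma pnat_coprime_neq (p q m n : nat) : p != q -> p.-nat m -> q.-nat n -> coprime m n.
Proof. by move=> npq; apply: sub_pnat_coprime => _ /eqnP->; rewrite !inE eq_sym. Qed.

Lemma pg_adj_commute G x y (q r : nat) :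
    q != r -> q.-elt x -> r.-elt y -> x != 1 -> y != 1 ->
  x \in G -> y \in G -> commute x y -> pg_adj G q r.
Proof.
move=> nqr qx ry ntx nty Gx Gy cxy.
apply: (pg_adj_dvd (x := x * y)); first exact: groupM.
have co : coprime #[x] #[y] := pnat_coprime_neq nqr qx ry.
by rewrite orderM // dvdn_mul ?p_elt_dvd_order.
Qed.

Lemma coset_Cauchy G H q :
  prime q -> q %| #|G / H| -> exists2 x, x \in G & #[coset H x] = q.
Proof.
move=> pq dv; have [_ /morphimP[x _ Gx ->] ox] := Cauchy pq dv.
by exists x.
Qed.

Lemma pg_adj_normal_pair N H1 H2 q r :
    prime q -> prime r -> coprime q r -> H1 <| N -> H2 <| N -> H1 * H2 = N ->
  q %| #|N / H1| -> r %| #|N / H2| -> pg_adj N q r.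
Proof.
move=> pq pr co nH1N nH2N defN qN rN.
have [nH1 nH2] := (normal_norm nH1N, normal_norm nH2N).
have [sH1N sH2N] := (normal_sub nH1N, normal_sub nH2N).
have [a H2a oa] : exists2 a, a \in H2 & #[coset H1 a] = q.
  by apply: coset_Cauchy; rewrite // -quotientMidl defN.
have [b H1b ob] : exists2 b, b \in H1 & #[coset H2 b] = r.
  by apply: coset_Cauchy; rewrite // -quotientMidr defN.
have [Na Nb] := (subsetP sH2N a H2a, subsetP sH1N b H1b).
apply: (pg_adj_dvd (x := a * b)); first exact: groupM.
rewrite Gauss_dvd // -{1}oa -ob -(coset_kerr a H1b) -(coset_kerl b H2a).
by rewrite !morph_order // (subsetP nH1, subsetP nH2) // groupM.
Qed.

Lemma pg_adjC G q r : pg_adj G q r -> pg_adj G r q.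
Proof. by rewrite /pg_adj mulnC. Qed.

Lemma not_pg_adj_subcent1 G (V : {group gT}) s (q r : nat) :
    ~ pg_adj G q r -> q != r -> q.-elt s -> s != 1 -> s \in G ->
  V \subset G -> r.-group V -> 'C_V[s] = 1.
Proof.
move=> no_qr nqr qs nts Gs sVG rV; apply/trivgP/subsetP=> v /setIP[Vv /cent1P cvs].
apply/set1P/eqP/negPn/negP=> ntv; apply: no_qr.
exact: pg_adj_commute nqr qs (mem_p_elt rV Vv) nts ntv Gs (subsetP sVG v Vv) (commute_sym cvs).
Qed.

End PrimeGraphEdges.

Section Order3Action.
Import ssralg GRing.Theory FiniteModule.
Variable gT : finGroupType.
Implicit Types (Q V : {group gT}) (t : gT).

Lemma fpf_class_lcoset Q t : t \in 'N(Q) -> 'C_Q[t] = 1 -> t ^: Q = t *: Q.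
Proof.
move=> nQt fpf; apply/eqP; rewrite eqEcard card_lcoset -index_cent1 fpf indexg1.
rewrite leqnn andbT; apply/subsetP=> _ /imsetP[d Qd ->].
by rewrite mem_lcoset -/([~ t, d]) commgEr groupM ?memJ_norm ?groupV.
Qed.

Lemma fpf_lcoset_order Q t c :
  t \in 'N(Q) -> 'C_Q[t] = 1 -> c \in Q -> #[t * c] = #[t].
Proof.
move=> nQt fpf Qc; have : t * c \in t ^: Q by rewrite fpf_class_lcoset // mem_lcoset mulKg.
by case/imsetP=> d _ ->; rewrite orderJ.
Qed.

Lemma order3_fpf_sum V (abV : abelian V) s (u : fmod_of abV) :
  s \in 'N(V) -> #[s] = 3 -> 'C_V[s] = 1 -> (u + u ^@ s + u ^@ s^-1 = 0)%R.
Proof.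
move=> nVs os fpf; set z := (u + _ + _)%R.
have s3 : s * s = s^-1.
  by apply/esym/eqP; rewrite eq_invg_mul -[s * (s * s)]/(s ^+ 3) -os expg_order.
have zs : (z ^@ s = z)%R.
  by rewrite /z !actAr -!actrM ?groupV // mulVg actr1 s3 addrC addrA.
have : fmval z \in 'C_V[s].
  by rewrite inE fmodP; apply/cent1P/commgP/conjg_fixP; rewrite -fmvalJ // zs.
by rewrite fpf => /set1P z1; apply: fmod_inj; rewrite z1 fmval0.
Qed.

Lemma fmod_fix_coprime V (abV : abelian V) (u : fmod_of abV) x n :
  coprime n #|V| -> x \in 'N(V) -> ((u *+ n) ^@ x = u *+ n)%R -> (u ^@ x = u)%R.
Proof.
move=> coV nVx fix_un; apply/eqP; rewrite -subr_eq0; apply/eqP.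
set w := (u ^@ x - u)%R.
have wn : fmval w ^+ n = 1 by rewrite -fmvalZ mulrnBl -actZr fix_un subrr fmval0.
have : #[fmval w] %| gcdn n #|V| by rewrite dvdn_gcd order_dvdn wn eqxx order_dvdG ?fmodP.
by rewrite (eqP coV) dvdn1 order_eq1 => /eqP w1; apply: fmod_inj; rewrite w1 fmval0.
Qed.

Lemma order3_fpf_cents Q V t :
    abelian V -> t \in 'N(Q) -> t \in 'N(V) -> Q \subset 'N(V) -> #[t] = 3 ->
    'C_Q[t] = 1 -> (forall c, c \in Q -> 'C_V[t * c] = 1) -> coprime #|Q| #|V| ->
  Q \subset 'C(V).
Proof.
move=> abV nQt nVt nVQ ot fpfQ fpfV coQV.
have nVc c : c \in Q -> c \in 'N(V) := subsetP nVQ c.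
pose Nm (u : fmod_of abV) := (\sum_(c in Q) u ^@ c)%R.
(* Summing u + u^s + u^(s^-1) = 0 over s in tQ makes |Q| u a Q-invariant. *)
have NmQ u q : q \in Q -> (Nm u ^@ q = Nm u)%R.
  move=> Qq; rewrite /Nm actr_sum (reindex_inj (mulIg q^-1)) /=.
  apply: eq_big => [c | c Qc]; first by rewrite groupMr ?groupV.
  by rewrite -actrM ?nVc ?mulgKV.
have sum_cosets u : (u *+ #|Q| + Nm (u ^@ t) + Nm u ^@ t^-1 = 0)%R.
  have Nm_inv : (\sum_(c in Q) u ^@ c^-1 = Nm u)%R.
    rewrite /Nm (reindex_inj invg_inj) /=.
    by apply: eq_big => [c | c _]; rewrite ?groupV ?invgK.
  have S0 : (\sum_(c in Q) (u + u ^@ t ^@ c + u ^@ c^-1 ^@ t^-1) = 0)%R.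
    apply: big1 => c Qc.
    have otc : #[t * c] = 3 by rewrite (fpf_lcoset_order nQt).
    have nVc' := nVc c Qc.
    have := order3_fpf_sum u (groupM nVt nVc') otc (fpfV c Qc).
    by rewrite invMg !actrM ?groupV.
  by rewrite !big_split /= sumr_const -actr_sum Nm_inv in S0.
apply/centsP=> q Qq v Vv; apply/commute_sym/commgP/conjg_fixP.
have fixQ : ((fmod abV v *+ #|Q|) ^@ q = fmod abV v *+ #|Q|)%R.
  set u := fmod abV v; have /eqP := sum_cosets u.
  rewrite -addrA addr_eq0 => /eqP ->.
  rewrite actNr actAr (NmQ _ _ Qq) -actrM ?groupV ?(nVc _ Qq) //.
  have -> : t^-1 * q = q ^ t * t^-1 by rewrite conjgE !mulgA mulgK.
  have Qqt : q ^ t \in Q by rewrite memJ_norm.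
  by rewrite actrM ?groupV ?(nVc _ Qqt) // NmQ.
have := fmod_fix_coprime coQV (nVc q Qq) fixQ.
by move/(congr1 fmval); rewrite fmvalJ ?(nVc _ Qq) // !fmodK.
Qed.

End Order3Action.

Section CoprimeAction.
Variable gT : finGroupType.
Implicit Types (N H : {group gT}) (y : gT).

Lemma coprime_quotient_cent_elt N H y (p q : nat) :
    prime p -> prime q -> q < p -> H <| N -> y \in 'N(N) -> y \in 'N(H) -> #[y] = p ->
    coprime p #|N| -> logn q #|N / H| = 1%N ->
  exists2 g, g \in 'C_N[y] & #[g] = q.
Proof.
move=> pp pq ltqp nHN nNy nHy oy coN lognq.
pose A := <[y]>%G.
have [nNA nHA] : A \subset 'N(N) /\ A \subset 'N(H) by rewrite !cycle_subG.
have oA : #|A| = p := oy.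
have pA : p.-group (A / H) by apply: morphim_pgroup; rewrite /pgroup oA pnat_id.
have coNA : coprime #|N / H| #|A / H|.
  rewrite coprime_sym (coprime_dvdl (dvdn_morphim _ _)) // oA.
  exact: coprime_dvdr (dvdn_morphim _ _) coN.
have solA : solvable A := abelian_sol (cycle_abelian y).
have [T sylT nTA] := sol_coprime_Sylow_exists q (quotient_sol H solA)
  (quotient_norms H nNA) coNA.
have oT : #|T| = q by rewrite (card_Hall sylT) p_part lognq expn1.
have cTA : q %| #|'C_T(A / H)|.
  have actT : [acts A / H, on T | 'J] by rewrite astabsJ.
  have := pgroup_fix_mod pA actT.
  rewrite -/(setI T _) afixJ oT => modE.
  have CTq : #|'C_T(A / H)| %| q by rewrite -oT cardSg ?subsetIl.
  case/primeP: (pq) => q_gt1 /(_ _ CTq) /orP[/eqP C1 | /eqP -> //].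
  move: modE; rewrite C1 !modn_small ?prime_gt1 // => q1.
  by rewrite q1 in q_gt1.
have sRN : H :&: [~: N, A] \subset N by rewrite subIset ?(normal_sub nHN).
have : q %| #|'C_N(A) / H|.
  rewrite strongest_coprime_quotient_cent ?solA ?orbT //.
    exact: dvdn_trans cTA (cardSg (setSI _ (pHall_sub sylT))).
  by rewrite oA coprime_sym (coprime_dvdr (cardSg sRN)).
move/dvdn_trans/(_ (dvdn_morphim _ _))/(Cauchy pq) => [g Cg og].
by exists g; rewrite // -cent_cycle.
Qed.

End CoprimeAction.

Section Order12.
Variable gT : finGroupType.
Implicit Types A : {group gT}.

Lemma card_Syl2_order12 A : #|A| = 12 -> #|'Syl_3(A)| = 4 -> #|'Syl_2(A)| = 1%N.
Proof.
move=> oA oSyl3; pose A3 := [set x : gT | #[x] == 3].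
suffices oA3 : #|A :&: A3| = 8.
  have defSyl2 P : P \in 'Syl_2(A) -> P :=: A :\: A3.
    rewrite inE pHallE oA p_part -natTrecE /= => /andP[sPA /eqP oP].
    apply/eqP; rewrite eqEcard -(leq_add2l 8) -{1}oA3 cardsID oA oP.
    rewrite andbT subsetD sPA; apply/exists_inP=> -[x] /= Px.
    by rewrite inE => /eqP ox; have:= order_dvdG Px; rewrite oP ox.
  have [/= P sylP] := Sylow_exists 2 A.
  have PS : P \in 'Syl_2(A) by rewrite inE sylP.
  apply/eqP/cards1P; exists P; apply/eqP; rewrite eqEsubset sub1set PS andbT.
  apply/subsetP=> Q sylQ; rewrite inE -val_eqE /=.
  by rewrite (defSyl2 Q sylQ) (defSyl2 P PS).
rewrite -[8]/(4 * 2)%N -{}oSyl3 -sum1_card -sum_nat_const.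
rewrite (partition_big (fun x => <[x]>%G) [in 'Syl_3(A)]) => [|x]; last first.
  by case/setIP=> Ax; rewrite /= !inE pHallE p_part cycle_subG Ax oA.
apply: eq_bigr => Q; rewrite inE pHallE oA p_part -?natTrecE //=.
case/andP=> sQA /eqP oQ; have:= oQ.
rewrite (cardsD1 1) group1 -sum1_card => [[/= <-]]; apply: eq_bigl => x.
rewrite setIC -val_eqE /= 2!inE in_setD1 -andbA -{4}[x]expg1 -order_dvdn dvdn1.
apply/and3P/andP=> [[/eqP-> _ /eqP <-] | [ntx Qx]]; first by rewrite cycle_id.
have:= order_dvdG Qx; rewrite oQ dvdn_divisors // mem_seq2 (negPf ntx) /=.
by rewrite eqEcard cycle_subG Qx (subsetP sQA) // oQ /order => /eqP->.
Qed.

Lemma order12_normalized_2group A : #|A| = 12 ->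
  exists (S : {group gT}) t,
    [/\ S \subset A, S :!=: 1, 2.-group S, t \in 'N_A(S) & #[t] = 3].
Proof.
move=> oA; have d3 : 3 %| #|A| by rewrite oA.
have [t At ot] := Cauchy (isT : prime 3) d3.
have: #|'Syl_3(A)| \in filter [pred d | d %% 3 == 1%N] (divisors 12).
  by rewrite mem_filter -dvdn_divisors //= -oA card_Syl_dvd ?card_Syl_mod.
rewrite /= mem_seq2 => /orP[/eqP n1 | /eqP n4].
- have [T sylT nTA] := normal_sylowP _ _ (introT eqP n1).
  have oT : #|T| = 3 by rewrite (card_Hall sylT) oA p_part -natTrecE.
  have Tt : t \in T by rewrite (mem_normal_Hall sylT nTA) // /p_elt ot pnat_id.
  have le2 : #|A : 'C_A[t]| <= 2.
    have sTt : t ^: A \subset T :\ 1.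
      apply/subsetP=> _ /imsetP[a Aa ->].
      by rewrite !inE conjg_eq1 -order_eq1 ot memJ_norm // (subsetP (normal_norm nTA)).
    rewrite index_cent1; apply: leq_trans (subset_leq_card sTt) _.
    by have := cardsD1 1 T; rewrite group1 oT add1n => -[<-].
  have d2 : 2 %| #|'C_A[t]|.
    have := Lagrange (subsetIl A 'C[t]); rewrite oA.
    case: #|A : _| le2 => [|[|[|//]]] _; rewrite ?muln0 ?muln1 //.
      by move=> ->.
    by move/(congr1 (divn^~ 2)); rewrite mulnK // => ->.
  have [c /setIP[Ac Ct] oc] := Cauchy (isT : prime 2) d2.
  exists <[c]>%G, t; split; rewrite ?cycle_subG ?cycle_eq1 -?order_gt1 ?oc //.
    by rewrite /pgroup -orderE oc.
  by rewrite inE At (subsetP (cent_sub _)) // cent_cycle cent1C.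
- have [S sylS nSA] := normal_sylowP _ _ (introT eqP (card_Syl2_order12 oA n4)).
  have oS : #|S| = 4 by rewrite (card_Hall sylS) oA p_part -natTrecE.
  exists S, t; split; rewrite ?normal_sub -?cardG_gt1 ?oS ?(pHall_pgroup sylS) //.
  by rewrite inE At (subsetP (normal_norm nSA)).
Qed.

End Order12.

Section Alt5.
Variables (gT : finGroupType) (B : {group gT}).
Hypothesis isoB : B \isog 'Alt_('I_5).

Lemma card_isog_Alt5 : #|B| = 60.
Proof.
rewrite (card_isog isoB); apply: double_inj.
by rewrite -mul2n card_Alt ?card_ord.
Qed.

Lemma simple_isog_Alt5 : simple B.
Proof. by rewrite (isog_simple isoB) simple_Alt5 ?card_ord. Qed.

Lemma nsol_isog_Alt5 : ~~ solvable B.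
Proof. by rewrite (isog_sol isoB) solvable_AltF ?card_ord. Qed.

Lemma isog_Alt5_normalized_2group : exists (S : {group gT}) t,
  [/\ S \subset B, S :!=: 1, 2.-group S, t \in 'N_B(S) & #[t] = 3].
Proof.
have /isogP[f injf defB] : 'Alt_('I_5) \isog B by rewrite isog_sym.
pose Ab := 'C_('Alt_('I_5))[ord0 | 'P].
have oAb : #|Ab| = 12.
  rewrite (card_isog (rfd_iso ord0)); apply: double_inj.
  by rewrite -mul2n card_Alt card_sig ?cardC1 ?card_ord.
have [S [t [sSAb ntS pS /setIP[Abt nSt] ot]]] :
    exists (S : {group gT}) t,
      [/\ S \subset f @* Ab, S :!=: 1, 2.-group S, t \in 'N_(f @* Ab)(S) & #[t] = 3].
  by apply: order12_normalized_2group; rewrite card_injm ?subsetIl.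
have sAbB : f @* Ab \subset B by rewrite -defB morphimS ?subsetIl.
exists S, t; split=> //; first exact: subset_trans sSAb sAbB.
by rewrite inE nSt (subsetP sAbB).
Qed.

End Alt5.

Section QuotientLift.
Variable gT : finGroupType.
Implicit Types X H : {group gT}.

Lemma quotient_lift_normalized_pgroup X H (S : {group coset_of H}) tb (q r : nat) :
    prime r -> q != r -> X \subset 'N(H) -> S \subset X / H -> q.-group S ->
    tb \in 'N_(X / H)(S) -> #[tb] = r ->
  exists (Q : {group gT}) t,
    [/\ Q \subset X, q.-group Q, Q / H = S, t \in 'N_X(Q) & #[t] = r].
Proof.
move=> pr nqr nHX sSX qS /setIP[Xtb nStb] otb.
pose M := (X :&: coset H @*^-1 S)%G; pose Y := (X :&: coset H @*^-1 'N(S))%G.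
have sMX : M \subset X := subsetIl _ _; have sYX : Y \subset X := subsetIl _ _.
have nMY : M <| Y.
  rewrite /normal setIS ?morphpreS ?normG //= normsI //.
    exact: subset_trans (subsetIl _ _) (normG X).
  exact: subset_trans (subsetIr _ _) (morphpre_norm _ _).
have [Q sylQ] := Sylow_exists q M.
have sQX : Q \subset X := subset_trans (pHall_sub sylQ) sMX.
have [w Nw Xw defTb] := morphimP Xtb.
have : w \in M * 'N_Y(Q).
  by rewrite (Frattini_arg nMY sylQ) inE Xw /= inE Nw /= inE -defTb.
case/mulsgP=> m n Mm /setIP[Yn nQn] defW.
have [Xm Xn] := (subsetP sMX m Mm, subsetP sYX n Yn).
have [Nm Nn] := (subsetP nHX m Xm, subsetP nHX n Xn).
have Sm : coset H m \in S by case/setIP: Mm => _ /morphpreP[].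
have NSn : coset H n \in 'N(S) by case/setIP: Yn => _ /morphpreP[].
have ocosetTb : #[coset S tb] = r.
  apply/(prime_nt_dvdP pr); rewrite -?otb ?morph_order // order_eq1.
  apply: contraL nqr => /eqP/(coset_idr nStb) Stb.
  have : (q : nat_pred).-elt tb := mem_p_elt qS Stb.
  by rewrite /p_elt otb pnatE // inE negbK eq_sym.
have r_n : r %| #[n].
  have defTb' : tb = coset H m * coset H n by rewrite defTb defW morphM.
  rewrite -ocosetTb defTb' coset_kerl //.
  exact: dvdn_trans (morph_order (coset_morphism S) NSn) (morph_order (coset_morphism H) Nn).
have sylQH : q.-Sylow(S) (Q / H).
  have -> : S = M / H :> {set _} by rewrite /= quotientE morphim_setIpre (setIidPr sSX).
  exact: morphim_pSylow (subset_trans sQX nHX) sylQ.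
exists Q, (n ^+ (#[n] %/ r)); split; rewrite ?order_expg_div ?(pHall_pgroup sylQ) //.
  exact: pHall_id sylQH qS.
by rewrite inE !groupX.
Qed.

End QuotientLift.

Section Alt5Quotient.
Variable gT : finGroupType.

Lemma Alt5_quotient_order3_not_fpf (X H V : {group gT}) (p : nat) :
    X \subset 'N(H) -> X / H \isog 'Alt_('I_5) -> ~ pg_adj X 2 3 ->
    abelian V -> V :!=: 1 -> p.-group V -> p != 2 -> X \subset 'N(V) ->
  ~ {in X, forall s, #[s] = 3 -> 'C_V[s] = 1}.
Proof.
move=> nHX isoXH no6 abV ntV pV p2 nVX fpfV.
have [S [tb [sSX ntS pS Ntb otb]]] := isog_Alt5_normalized_2group isoXH.
have [Q [t [sQX pQ defS /setIP[Xt nQt] ot]]] :=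
  quotient_lift_normalized_pgroup (isT : prime 3) (isT : 2 != 3) nHX sSX pS Ntb otb.
have fpfQ : 'C_Q[t] = 1.
  apply: not_pg_adj_subcent1 (fun h => no6 (pg_adjC h)) _ _ _ Xt sQX pQ => //.
    by rewrite /p_elt ot pnat_id.
  by rewrite -order_gt1 ot.
have cQV : Q \subset 'C(V).
  apply: (order3_fpf_cents abV nQt (subsetP nVX t Xt) (subset_trans sQX nVX) ot fpfQ).
    move=> c Qc; apply: fpfV; last by rewrite (fpf_lcoset_order nQt).
    by rewrite groupM // (subsetP sQX).
  by apply: (pnat_coprime_neq _ pQ pV); rewrite eq_sym.
pose C := 'C_X(V).
have nCX : C <| X by have := subcent_normal X V; rewrite (setIidPl nVX).
case/simpleP: (simple_isog_Alt5 isoXH) => _ /(_ (C / H)%G (morphim_normal _ nCX)).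
case=> [C1 | CX].
  have : S \subset C / H by rewrite -defS quotientS // subsetI sQX.
  by rewrite /= C1 subG1 (negPf ntS).
have d3 : 3 %| #|C|.
  apply: dvdn_trans (dvdn_morphim (coset_morphism H) _).
  by rewrite /= CX (card_isog_Alt5 isoXH).
have [c /setIP[Xc cVc] oc] := Cauchy (isT : prime 3) d3.
have : V \subset 'C_V[c] by rewrite subsetI subxx sub_cent1.
by rewrite fpfV // subG1 (negPf ntV).
Qed.

Lemma Alt5_quotient_kernel_ndvd (K H : {group gT}) (p : nat) :
    prime p -> p != 2 -> p != 3 -> H <| K -> K / H \isog 'Alt_('I_5) ->
    ~ pg_adj K 2 3 -> ~ pg_adj K 3 p ->
  ~~ (p %| #|H|).
Proof.
move=> pp p2 p3 nHK isoKH no6 no3p; apply/negP=> pH.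
have [sHK nHK'] := andP nHK.
have [P sylP] := Sylow_exists p H; have pP := pHall_pgroup sylP.
pose X := 'N_K(P); pose V := 'Z(P).
have sXK : X \subset K := subsetIl _ _.
have defXH : X / H = K / H by rewrite -(Frattini_arg nHK sylP) quotientMidl.
have isoXH : X / H \isog 'Alt_('I_5) by rewrite defXH.
have sVK : V \subset K.
  exact: subset_trans (center_sub P) (subset_trans (pHall_sub sylP) sHK).
have pV : p.-group V := pgroupS (center_sub P) pP.
have ntV : V :!=: 1.
  rewrite center_nil_eq1 ?(pgroup_nil pP) // -cardG_gt1 (card_Hall sylP).
  by rewrite p_part_gt1 mem_primes pp pH cardG_gt0.
have nVX : X \subset 'N(V) := char_norm_trans (center_char P) (subsetIr K _).
have no6X : ~ pg_adj X 2 3 := fun h => no6 (pg_adjS sXK h).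
apply: (Alt5_quotient_order3_not_fpf (subset_trans sXK nHK') isoXH no6X
          (center_abelian P) ntV pV p2 nVX).
move=> s Xs os; apply: not_pg_adj_subcent1 no3p _ _ _ (subsetP sXK s Xs) sVK pV.
- by rewrite eq_sym.
- by rewrite /p_elt os pnat_id.
- by rewrite -order_gt1 os.
Qed.

End Alt5Quotient.

Section Alt5Section.
Variable gT : finGroupType.

Lemma Alt5_section_pg_adj (G N H : {group gT}) y (p : nat) :
    prime p -> 3 < p -> N \subset G -> y \in G -> y \in 'N(N) -> #[y] = p ->
    coprime p #|N| -> H <| N -> N / H \isog 'Alt_('I_5) ->
  pg_adj G 3 p \/ pg_adj G 3 5.
Proof.
move=> pp gt3p sNG Gy nNy oy coN nHN isoNH.
have oNH := card_isog_Alt5 isoNH.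
have nHN' := normal_norm nHN.
have [nHy | nHy] := boolP (y \in 'N(H)).
  left; have log3 : logn 3 #|N / H| = 1%N by rewrite oNH.
  have [g /setIP[Ng /cent1P cgy] og] :=
    coprime_quotient_cent_elt pp (isT : prime 3) gt3p nHN nNy nHy oy coN log3.
  apply: (pg_adj_dvd (x := g * y)); first exact: groupM (subsetP sNG g Ng) Gy.
  have co : coprime #[g] #[y] by rewrite og oy prime_coprime // dvdn_prime2 // ltn_eqF.
  by rewrite orderM // og oy.
right; apply: pg_adjS sNG _.
pose Hy := (H :^ y)%G.
have nHyN : Hy <| N by rewrite -(normP nNy) normalJ.
have nHHy : Hy \subset 'N(H) := subset_trans (normal_sub nHyN) nHN'.
have defN : H * Hy = N.
  have nJN : H <*> Hy <| N := normalY nHN nHyN.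
  have nJH : H <| H <*> Hy := normalS (joing_subl _ _) (normal_sub nJN) nHN.
  case/simpleP: (simple_isog_Alt5 isoNH) => _ /(_ _ (morphim_normal _ nJN)) [J1 | JN].
    have sJH : H <*> Hy \subset H.
      by rewrite -quotient_sub1 ?J1 // (subset_trans (normal_sub nJN)).
    case/negP: nHy; apply/normP/eqP.
    by rewrite eqEcard (subset_trans (joing_subr _ _) sJH) cardJg leqnn.
  by rewrite -norm_joinEr // (quotient_inj nJH nHN JN).
have oNHy : #|N / Hy| = 60.
  by rewrite -oNH !card_quotient ?normal_norm // -!divgS ?normal_sub //= cardJg.
by apply: (pg_adj_normal_pair _ _ _ nHN nHyN defN); rewrite ?oNH ?oNHy.
Qed.

End Alt5Section.

Section DerivedSeries.
Variable gT : finGroupType.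
Implicit Types N L H : {group gT}.

Lemma derg_der1 N n : N^`(1)^`(n) = N^`(n.+1).
Proof. by elim: n => // n IHn; rewrite !dergSn IHn. Qed.

Lemma nsol_normal_abelian N H :
  H <| N -> abelian (N / H) -> ~~ solvable N -> ~~ solvable H.
Proof.
by move=> nHN abNH; apply: contra => solH; rewrite (series_sol nHN) solH abelian_sol.
Qed.

Lemma der_Alt5_section N L H k :
    L \subset N -> N^`(k) \subset L -> H <| L -> L / H \isog 'Alt_('I_5) ->
  N^`(k) / (N^`(k) :&: H) \isog 'Alt_('I_5).
Proof.
move=> sLN sDL nHL isoLH; have [sHL nHL'] := andP nHL.
have nDL : N^`(k) <| L := normalS sDL sLN (der_normal k N).
have nHD : N^`(k) \subset 'N(H) := subset_trans sDL nHL'.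
case/simpleP: (simple_isog_Alt5 isoLH) => _ /(_ _ (morphim_normal _ nDL)) [D1 | DL].
  have sDH : N^`(k) \subset H by rewrite -quotient_sub1 // D1.
  have sLkH : L^`(k) \subset H := subset_trans (dergS k sLN) sDH.
  case/negP: (nsol_isog_Alt5 isoLH); apply/derivedP; exists k.
  by apply/trivgP; rewrite /= -quotient_der // quotient_sub1 // (subset_trans (der_sub k L)).
by rewrite setIC (isog_trans (second_isog nHD)) //= DL.
Qed.

End DerivedSeries.

Section CompositionSeries.
Variable gT : finGroupType.
Implicit Types N : {group gT}.

Lemma comps_cons N N1 s : comps N (N1 :: s) -> N1 <| N /\ comps N1 s.
Proof.
by case/compsP=> /= lastE /andP[mxN1 pth]; split; [exact: maxnormal_normal | apply/compsP].
Qed.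

Lemma comps_nil_sol N : comps N [::] -> solvable N.
Proof. by case/compsP=> /= -> _; apply: solvable1. Qed.

Lemma comps_Alt5_section s N :
    comps N s -> good_factors N s -> ~~ solvable N ->
  exists k (L H : {group gT}),
    [/\ L \subset N, N^`(k) \subset L, H <| L & L / H \isog 'Alt_('I_5)].
Proof.
elim: s N => [|N1 s IHs] N; first by move/comps_nil_sol->.
case/comps_cons=> nN1N cN1; rewrite /good_factors /=.
case/andP=> /orP[cycN | isoN] gf nsolN; last by exists 0%N, N, N1; rewrite derg0 subxx.
have abN := cyclic_abelian cycN.
have [k [L [H [sLN1 sN1kL nHL isoLH]]]] :=
  IHs N1 cN1 gf (nsol_normal_abelian nN1N abN nsolN).
exists k.+1, L, H; split=> //; first exact: subset_trans sLN1 (normal_sub nN1N).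
rewrite -derg_der1; apply: subset_trans sN1kL; apply: dergS.
exact: der1_min (normal_norm nN1N) abN.
Qed.

End CompositionSeries.

Section PrimeGraphWalk.
Variables (gT : finGroupType) (G : {group gT}) (p : nat).
Hypotheses (pp : prime p) (p2 : p != 2) (p3 : p != 3) (p5 : p != 5).
Hypotheses (no6 : ~ pg_adj G 2 3) (no15 : ~ pg_adj G 3 5) (no3p : ~ pg_adj G 3 p).

Lemma prime_ndvd60 : ~~ (p %| 60).
Proof.
rewrite (_ : 60 = 2 * (2 * (3 * 5)))%N // !Euclid_dvdM //.
by rewrite !dvdn_prime2 // (negPf p2) (negPf p3) (negPf p5).
Qed.

Lemma prime_gt3 : 3 < p.
Proof. by case: p pp p2 p3 => [|[|[|[|]]]]. Qed.

Lemma comps_ndvd s (N : {group gT}) :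
  comps N s -> good_factors N s -> ~~ solvable N -> N \subset G -> ~~ (p %| #|N|).
Proof.
elim: s N => [|N1 s IHs] N; first by move/comps_nil_sol->.
case/comps_cons=> nN1N cN1; rewrite /good_factors /= => /andP[gfN gf] nsolN sNG.
have sN1G := subset_trans (normal_sub nN1N) sNG.
apply/negP=> pN; have [pN1 | p'N1] := boolP (p %| #|N1|).
  case/orP: gfN => [cycN | isoN].
    have nsolN1 := nsol_normal_abelian nN1N (cyclic_abelian cycN) nsolN.
    by case/negP: (IHs N1 cN1 gf nsolN1 sN1G).
  case/negP: (Alt5_quotient_kernel_ndvd pp p2 p3 nN1N isoN
               (fun h => no6 (pg_adjS sNG h)) (fun h => no3p (pg_adjS sNG h))).
  exact: pN1.
have pNN1 : p %| #|N / N1|.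
  move: pN; rewrite -(Lagrange (normal_sub nN1N)) Euclid_dvdM // (negPf p'N1).
  by rewrite card_quotient ?normal_norm.
case/orP: gfN => [cycN | isoN]; last first.
  by case/negP: prime_ndvd60; rewrite -(card_isog_Alt5 isoN).
have nsolN1 := nsol_normal_abelian nN1N (cyclic_abelian cycN) nsolN.
have [k [L [H [sLN1 sN1kL nHL isoLH]]]] := comps_Alt5_section cN1 gf nsolN1.
have [y Ny oy] := Cauchy pp pN.
have nN1ky : y \in 'N(N1^`(k)).
  exact: subsetP (char_norm_trans (der_char k N1) (normal_norm nN1N)) y Ny.
have coN1k : coprime p #|N1^`(k)|.
  rewrite prime_coprime //; apply: contra p'N1 => /dvdn_trans; apply.
  exact: cardSg (der_sub k N1).
have nHk : N1^`(k) :&: H <| N1^`(k) := normalGI sN1kL nHL.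
have [] := Alt5_section_pg_adj pp prime_gt3 (subset_trans (der_sub k N1) sN1G)
  (subsetP sNG y Ny) nN1ky oy coN1k nHk (der_Alt5_section sLN1 sN1kL nHL isoLH).
  exact: no3p.
exact: no15.
Qed.

End PrimeGraphWalk.

Theorem mainTheorem5 (gT : finGroupType) (G : {group gT}) :
  strictly_pseudo_solvable G ->
  cpg_edge G 2 3 -> cpg_edge G 2 5 -> cpg_edge G 3 5 ->
  forall p : nat, prime p -> p %| #|G| -> p != 2 -> p != 3 -> p != 5 ->
    ~ cpg_edge G 3 p.
Proof.
move=> [psG nsolG] [_ no6] _ [_ no15] p pp pG p2 p3 p5 [_ no3p].
have [s csG] := exists_comps G.
by case/negP: (comps_ndvd pp p2 p3 p5 no6 no15 no3p csG (psG s csG) nsolG (subxx G)).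
Qed.
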